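(* Let $n>2$ be an integer with prime factorization $n=p_1^{h_1}\cdots p_k^{h_k}$, and let $n_0=p_1^{\lfloor nh_1/2\rfloor}\cdots p_k^{\lfloor nh_k/2\rfloor}$. Let $m\neq 0,\pm1$ be an integer such that both $m$ and $m+n_0^n$ are square-free. Let $\vartheta=\sqrt[n]{m}$ and $\gamma=\sqrt[n]{m+n_0^n}$. Then the integral bases of $\mathbb{Q}(\vartheta)$ and $\mathbb{Q}(\gamma)$ have the same structure in terms of $\vartheta$ and $\gamma$ respectively: for integers $a_{j,i}$ and positive integers $q_j$ ($1\le j\le n$, $0\le i\le n-1$), the elements \[ b_j=\frac{a_{j,0}+a_{j,1}\vartheta+\cdots+a_{j,n-1}\vartheta^{n-1}}{q_j}\quad(1\le j\le n) \] form an integral basis of $\mathbb{Q}(\vartheta)$ if and only if the elements \[ b_j'=\frac{a_{j,0}+a_{j,1}\gamma+\cdots+a_{j,n-1}\gamma^{n-1}}{q_j}\quad(1\le j\le n) \] form an integral basis of $\mathbb{Q}(\gamma)$.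
   Context: $\lfloor x\rfloor$ denotes the integer part of $x$. An integral basis of a number field $L$ is a $\mathbb{Z}$-basis of its ring of integers.
   Formalization: Added hypotheses: m+n_0^n ≠ 1, and n is a power of 2 if m+n_0^n = −1; in the excluded cases Q(γ) has degree below n and the claim fails (e.g. n=3, n_0=3, m=−26). *)

(* Defs.v *)
From HB Require Import structures.
From mathcomp Require Import all_boot all_order all_algebra all_field.

Set Implicit Arguments.
Unset Strict Implicit.
Unset Printing Implicit Defensive.

Import Order.TTheory GRing.Theory Num.Theory.

Local Open Scope ring_scope.

(* 0 is not square-free, whereas 1 and -1 are. *)
Definition squarefree (z : int) : Prop :=
  forall d : int, (d ^+ 2 %| z)%Z -> d \is a GRing.unit.

Definition n0 (n : nat) : nat :=
  (\prod_(p <- primes n) p ^ (n * logn p n)./2)%N.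

(* A number field is a subfield K of a finite extension L of rat. *)
Definition ring_of_integers (L : fieldExtType rat) (K : {subfield L}) (x : L)
    : Prop :=
  x \in K /\ integralOver (intr : int -> L) x.

Definition integral_basis (L : fieldExtType rat) (K : {subfield L}) (d : nat)
    (b : 'I_d -> L) : Prop :=
  [/\ forall j, ring_of_integers K (b j),
      forall x, ring_of_integers K x ->
        exists c : 'I_d -> int, x = \sum_(j < d) b j *~ c j
    & forall c : 'I_d -> int,
        \sum_(j < d) b j *~ c j = 0 -> forall j, c j = 0].

Definition basis_elt (L : fieldExtType rat) (n : nat)
    (a : 'I_n -> 'I_n -> int) (q : 'I_n -> int) (x : L) (j : 'I_n) : L :=
  (\sum_(i < n) (a j i)%:~R * x ^+ i) / (q j)%:~R.

(* Main.v *)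
Require Import Defs.
From HB Require Import structures.
From mathcomp Require Import all_boot all_order all_algebra all_field.
From mathcomp Require Import zify ring.

Set Implicit Arguments.
Unset Strict Implicit.
Unset Printing Implicit Defensive.

Import Order.TTheory GRing.Theory Num.Theory.

Local Open Scope ring_scope.

(* Let [C] be the companion matrix of [X^n - c], so that [f(x)] acts on the
   basis [1, x, ..., x^(n-1)] of [Q(x)], [x^n = c], as [f(C)]; then [f(x)] is an
   integer iff [f(C)] has an integral characteristic polynomial. The traces of
   [f(x) x^(n-j)] show that [n c f] is integral when [f(x)] is, and, [X^n - c]
   being Eisenstein at every prime dividing the square-free [c], already
   [n f =: h] is. Finally [n^n det (X - h(C) / n) = det (n X - h(C))] depends
   modulo [n^n] only on [c] modulo [n^n], so the integrality of [f(x)] depends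
   on [c] only modulo [n^n]; and [n] divides [n0 n]. *)

(** * Powers and traces of the companion matrix *)

(* The companion matrix of ['X^(n.+1) - c%:P]. *)
Definition rootmx (R : comNzRingType) (n : nat) (c : R) : 'M[R]_n.+1 :=
  \matrix_(i, j) (if i == ord_max then c *+ (j == ord0) else (j == i.+1 :> nat)%:R).

Lemma map_rootmx (R S : comNzRingType) (f : {rmorphism R -> S}) n (c : R) :
  map_mx f (rootmx n c) = rootmx n (f c).
Proof.
by apply/matrixP=> i j; rewrite !mxE; case: ifP => _; [exact: raddfMn | exact: rmorph_nat].
Qed.

Lemma ltn_ord_max n (i : 'I_n.+1) : i != ord_max -> (i.+1 < n.+1)%N.
Proof. by rewrite -val_eqE /=; have := ltn_ord i; lia. Qed.

Lemma rootmx_mulE (R : comNzRingType) n (c : R) p (A : 'M[R]_(n.+1, p)) i j :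
  (rootmx n c *m A) i j =
  if i == ord_max then c * A ord0 j else A (inord i.+1) j.
Proof.
rewrite mxE; have [->|iN] := eqVneq i ord_max.
  rewrite (bigD1 ord0) //= big1 ?addr0 ?mxE ?eqxx // => k /negPf kN.
  by rewrite !mxE eqxx kN mulr0n mul0r.
have ltin := ltn_ord_max iN.
rewrite (bigD1 (inord i.+1)) //= big1 ?addr0 ?mxE ?(negPf iN) ?inordK ?eqxx ?mul1r //.
move=> k; rewrite -val_eqE /= inordK // => /negPf kN.
by rewrite mxE (negPf iN) kN mul0r.
Qed.

(** Row [i] of the [k]-th power lists the coordinates of [x ^ (i + k)]. For [k <= n.+1] the exponent
    stays below [2 * n.+1], so it wraps around at most once and picks up at most one factor [c]. *)
Lemma rootmx_expE (R : comNzRingType) n (c : R) k i j : (k <= n.+1)%N ->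
  (rootmx n c ^+ k) i j =
  if (i + k == j)%N then 1 else if (i + k == n.+1 + j)%N then c else 0.
Proof.
elim: k i j => [|k IHk] i j lekn.
  rewrite expr0 mxE addn0 -val_eqE; case: eqP => //= _; case: eqP => // e.
  by have := ltn_ord i; rewrite e; lia.
rewrite exprS -[_ * _]/(_ *m _) rootmx_mulE; have ltj := ltn_ord j.
have [->|iN] := eqVneq i ord_max; rewrite IHk ?(ltnW lekn) //=.
  rewrite add0n; have [->|kj] := eqVneq k j.
    by rewrite mulr1; repeat case: eqP; rewrite //; lia.
  by have -> : (k == n.+1 + j)%N = false; [lia|rewrite mulr0; repeat case: eqP; rewrite //; lia].
have ltin := ltn_ord_max iN.
by rewrite inordK // addSnnS.
Qed.

Lemma rootmx_exp_size (R : comNzRingType) n (c : R) :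
  rootmx n c ^+ n.+1 = c%:M.
Proof.
apply/matrixP=> i j; rewrite rootmx_expE // mxE -val_eqE /=.
have := ltn_ord j; have := ltn_ord i.
by case: (eqVneq (i : nat) j); repeat case: eqP; rewrite ?mulr1n ?mulr0n //; lia.
Qed.

Lemma mxtrace_rootmx_exp (R : comNzRingType) n (c : R) k :
  (0 < k < n.+1 + n.+1)%N ->
  \tr (rootmx n c ^+ k) = if k == n.+1 then c *+ n.+1 else 0.
Proof.
have tr0 l : (0 < l <= n)%N -> \tr (rootmx n c ^+ l) = 0.
  move=> lr; rewrite /mxtrace big1 // => i _; rewrite rootmx_expE; last by lia.
  by have := ltn_ord i; repeat case: eqP => //; lia.
move=> kr; case: (ltngtP k n.+1) => kn.
- by apply: tr0; lia.
- rewrite -(subnK (ltnW kn)) addnC exprD rootmx_exp_size.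
  by rewrite -[_ * _]/(_ *m _) mul_scalar_mx mxtraceZ tr0 ?mulr0 //; lia.
- by rewrite kn rootmx_exp_size mxtrace_scalar.
Qed.

(** The shift by ['X^(n.+1 - j)] moves the [j]-th term of [f] to exponent [n.+1], the only one
    between [1] and [2 * n + 1] whose power has a nonzero trace. Traces thus read off the
    coefficients of [f]. *)
Lemma rootmx_horner_trace (R : comNzRingType) n (c : R) (f : {poly R}) j :
  (size f <= n.+1)%N -> (j <= n)%N ->
  \tr (horner_mx (rootmx n c) (f * 'X^(n.+1 - j))) = f`_j * c *+ n.+1.
Proof.
move=> sf jn; rewrite -{1}[f]coefK poly_def mulr_suml raddf_sum /= raddf_sum /=.
under eq_bigr => i _.
  rewrite -scalerAl -exprD linearZ /= rmorphXn /= horner_mx_X linearZ /=.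
  rewrite mxtrace_rootmx_exp; last by have := leq_trans (ltn_ord i) sf; lia.
  over.
have [jf|jf] := ltnP j (size f); last first.
  rewrite nth_default // mul0r mul0rn big1 // => i _.
  have -> : (i + (n.+1 - j) == n.+1)%N = false by have := leq_trans (ltn_ord i) jf; lia.
  by rewrite mulr0.
rewrite (bigD1 (Ordinal jf)) //= subnKC ?(leqW jn) // eqxx big1 ?addr0 ?mulrnAr //.
move=> i; rewrite -val_eqE /= => ij.
have -> : (i + (n.+1 - j) == n.+1)%N = false by lia.
by rewrite mulr0.
Qed.

(* The powers of [x] form an eigenvector for the whole algebra generated by
   the matrix. *)
Lemma horner_rootmx_powers (R S : comNzRingType) (f : {rmorphism R -> S}) n
    (c : R) (x : S) (p : {poly R}) : x ^+ n.+1 = f c ->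
  map_mx f (horner_mx (rootmx n c) p) *m (\col_i x ^+ i) =
  (map_poly f p).[x] *: (\col_(i < n.+1) x ^+ i).
Proof.
move=> xn; elim/poly_ind: p => [|p a IHp].
  by rewrite !rmorph0 horner0 scale0r mul0mx.
have step : map_mx f (rootmx n c) *m (\col_i x ^+ i) = x *: (\col_(i < n.+1) x ^+ i).
  apply/matrixP=> i j; rewrite map_rootmx rootmx_mulE !mxE.
  have [->|iN] := eqVneq i ord_max; first by rewrite mulr1 -exprS xn.
  have ltin := ltn_ord_max iN.
  by rewrite inordK // exprS.
rewrite !rmorphD !rmorphM /= horner_mx_X horner_mx_C map_polyX map_polyC /=.
rewrite map_scalar_mx mulmxDl -mulmxE -mulmxA step -scalemxAr IHp.
by rewrite mul_scalar_mx hornerD hornerMX hornerC scalerA scalerDl mulrC.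
Qed.

(** * Integrality of [f(x)] read on a characteristic polynomial *)

(** Every eigenvalue is a root of the minimal polynomial, hence of [g], hence an algebraic integer.
    The coefficients of the characteristic polynomial are then both algebraic integers and
    rational. *)
Lemma char_poly_polyOver_int n (A : 'M[rat]_n.+1) (g : {poly int}) :
  g \is monic -> horner_mx A (map_poly intr g) = 0 ->
  char_poly A \is a polyOver Num.int.
Proof.
move=> mg gA0; pose P := map_poly (ratr : rat -> algC) (char_poly A).
have Pover : P \is a polyOver Aint.
  have [r Pr] := closed_field_poly_normal P.
  have mP : lead_coef P = 1 by apply/eqP/monic_map/char_poly_monic.
  rewrite Pr mP scale1r big_seq rpred_prod // => z zr.
  rewrite polyOverXsubC; have /root_monic_Aint: root (map_poly intr g) z.
    have Pz : root P z by rewrite Pr mP scale1r root_prod_XsubC.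
    move: Pz; rewrite /P map_char_poly -root_mxminpoly; apply: root_dvdp.
    apply: mxminpoly_min; have := congr1 (map_mx (ratr : rat -> algC)) gA0.
    rewrite map_horner_mx map_mx0 -map_poly_comp.
    by rewrite (eq_map_poly (fun x => ratr_int _ x)).
  apply; first exact: monic_map.
  by apply/polyOverP=> i; rewrite coef_map /= intr_int.
apply/polyOverP=> i; rewrite -Cint_rat -coef_map.
apply: Cint_rat_Aint; first by rewrite coef_map Crat_rat.
exact: (polyOverP Pover).
Qed.

(** This is the form in which the irreducibility of [X^n - c] reaches the integrality arguments. *)
Definition powers_free (L : fieldExtType rat) (n : nat) (x : L) : Prop :=
  forall f : {poly rat},
    (size f <= n)%N -> (map_poly (in_alg L) f).[x] = 0 -> f = 0.

Lemma powers_mx_eq0 (L : fieldExtType rat) n (x : L) (A : 'M[rat]_n.+1) :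
  powers_free n.+1 x ->
  map_mx (in_alg L) A *m (\col_(i < n.+1) x ^+ i) = 0 -> A = 0.
Proof.
move=> indep A0; apply/row_matrixP=> i; rewrite row0.
suff e : rVpoly (row i A) = 0 by rewrite -[row i A]rVpolyK e linear0.
apply: indep; first exact: size_poly.
have /matrixP/(_ i ord0) := A0; rewrite !mxE => <-.
rewrite (horner_coef_wide _ (n := n.+1)).
  by apply: eq_bigr => j _; rewrite coef_map coef_rVpoly_ord !mxE.
by rewrite size_map_poly size_poly.
Qed.

Lemma map_in_alg_intr (L : fieldExtType rat) (g : {poly int}) :
  map_poly (in_alg L) (map_poly intr g) = map_poly intr g.
Proof.
rewrite -map_poly_comp; apply: eq_map_poly => z.
exact: (rmorph_int (in_alg L)).
Qed.

(** The vector of powers of [x] is an eigenvector of [A] for [f(x)]. If a monic [g] kills [f(x)],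
    then [g(A)] kills this vector, so [g(A) = 0] by independence. Conversely, Cayley-Hamilton makes
    the characteristic polynomial vanish at [f(x)], as the coordinate of index 0 of the vector is
    1. *)
Lemma integral_char_poly (L : fieldExtType rat) n (c : rat) (x : L)
    (f : {poly rat}) :
  powers_free n.+1 x ->
  x ^+ n.+1 = in_alg L c ->
  integralOver (intr : int -> L) (map_poly (in_alg L) f).[x] <->
  char_poly (horner_mx (rootmx n c) f) \is a polyOver Num.int.
Proof.
move=> indep xn; set A := horner_mx _ f.
have eig g : map_mx (in_alg L) (horner_mx A g) *m (\col_i x ^+ i) =
    (map_poly (in_alg L) g).[(map_poly (in_alg L) f).[x]] *: (\col_(i < n.+1) x ^+ i).
  have -> : horner_mx A g = horner_mx (rootmx n c) (g \Po f).
    elim/poly_ind: g => [|g a IHg]; first by rewrite comp_poly0 !rmorph0.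
    rewrite comp_polyD comp_polyM comp_polyX comp_polyC.
    by rewrite !rmorphD !rmorphM /= IHg horner_mx_X !horner_mx_C.
  by rewrite (horner_rootmx_powers _ xn) map_comp_poly horner_comp.
split=> [[g mg /rootP g0] | /floorpP[g cg]].
  apply: (char_poly_polyOver_int mg); apply: (powers_mx_eq0 indep).
  by rewrite eig map_in_alg_intr g0 scale0r.
exists g.
  have := char_poly_monic A.
  rewrite cg !monicE lead_coef_map_inj //; last exact: intr_inj.
  by rewrite -(eqr_int rat).
have := eig (char_poly A); rewrite Cayley_Hamilton map_mx0 mul0mx cg map_in_alg_intr.
by move/matrixP/(_ ord0 ord0); rewrite !mxE expr0 mulr1 => /esym/rootP.
Qed.

(** * Dependence of the characteristic polynomial on [c] *)

Lemma intr_Zp_eq0 (K : nat) (x : int) : (1 < K)%N ->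
  (x%:~R == 0 :> 'Z_K) = (K %| x)%Z.
Proof.
move=> K1; have nat0 (k : nat) : (k%:R == 0 :> 'Z_K) = (K %| k)%N.
  by rewrite -val_eqE /= val_Zp_nat.
case: x => k; first by rewrite -[k%:~R]/(k%:R) nat0.
by rewrite NegzE rmorphN /= oppr_eq0 nat0 dvdzE abszN.
Qed.

(* Multiplying [char_poly (n^-1 h(C))] by [n ^ n] gives the integral polynomial
   [det (n X - h(C))], which depends only on [c] modulo [n ^ n]. *)
Lemma char_poly_scale_congr n (N : nat) (c c' : int) (h : {poly int}) :
  (1 < N)%N -> ((N ^ n.+1)%N %| c - c')%Z ->
  char_poly (horner_mx (rootmx n c%:~R) (N%:R^-1 *: map_poly intr h)) -
  char_poly (horner_mx (rootmx n c'%:~R) (N%:R^-1 *: map_poly intr h))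
    \is a polyOver (Num.int : {pred rat}).
Proof.
move=> N1 cc'; set K := (N ^ n.+1)%N.
(* ['Z_K] is the ring of integers modulo [K] only when [K > 1]. *)
have K1 : (1 < K)%N by rewrite -(exp1n n.+1) ltn_exp2r.
pose D (b : int) : {poly int} :=
  \det ((N%:R *: 'X)%:M - map_mx polyC (horner_mx (rootmx n b) h)).
have Nq : N%:R != 0 :> rat by rewrite pnatr_eq0; lia.
have Dmap (S : comNzRingType) b : map_poly intr (D b) =
    \det ((N%:R *: 'X)%:M -
          map_mx polyC (horner_mx (rootmx n b%:~R) (map_poly intr h))) :> {poly S}.
  rewrite -det_map_mx -(map_rootmx (intr : {rmorphism int -> S})) -map_horner_mx.
  rewrite map_mxB map_scalar_mx /= map_polyZ map_polyX /= natz; congr (\det (_ - _)).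
  by apply/matrixP=> i j; rewrite !mxE /= map_polyC.
have DE b : map_poly intr (D b) =
  K%:R *: char_poly (horner_mx (rootmx n b%:~R) (N%:R^-1 *: map_poly intr h)) :> {poly rat}.
  have -> : K%:R = (N%:R) ^+ n.+1 :> rat by rewrite natrX.
  have -> : forall B : 'M[{poly rat}]_n.+1, N%:R ^+ n.+1 *: \det B = \det (N%:R%:P *: B).
    by move=> B; rewrite detZ -mul_polyC polyC_exp.
  rewrite Dmap; congr (\det _); rewrite linearZ /= /char_poly_mx scalerBr.
  rewrite scale_scalar_mx mul_polyC; congr (_ - _).
  by apply/matrixP=> i j; rewrite !mxE -polyCM mulrA divff ?mul1r.
(* The determinant commutes with reduction modulo [K], and [c] and [c'] have the same image in
   ['Z_K]. *)
have dvdD i : (K %| (D c)`_i - (D c')`_i)%Z.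
  rewrite -intr_Zp_eq0 // rmorphB subr_eq0 /= -!coef_map /= !Dmap.
  suff -> : c%:~R = c'%:~R :> 'Z_K by [].
  by apply/eqP; rewrite -subr_eq0 -rmorphB intr_Zp_eq0.
apply/polyOverP=> i.
have /dvdzP[z ez] := dvdD i.
have Kq : K%:R != 0 :> rat by rewrite pnatr_eq0; lia.
have coefD b : (char_poly (horner_mx (rootmx n b%:~R) (N%:R^-1 *: map_poly intr h)))`_i
   = ((D b)`_i)%:~R / K%:R :> rat.
  have /(congr1 (fun p : {poly rat} => p`_i)) := DE b.
  by rewrite coef_map coefZ /= => ->; rewrite mulrC mulKf.
rewrite coefB !coefD -mulrBl -rmorphB /= ez rmorphM /= mulfK ?intr_int //.
Qed.

(** * Denominators of algebraic integers *)

Lemma integral_exp (R K : comNzRingType) (f : {rmorphism R -> K}) (u : K) k :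
  integralOver f u -> integralOver f (u ^+ k).
Proof.
move=> iu; elim: k => [|k IHk]; first exact: integral1.
by rewrite exprS; apply: integral_mul.
Qed.

Lemma integral_int_root (K : comNzRingType) n (c : int) (x : K) :
  x ^+ n.+1 = c%:~R -> integralOver (intr : int -> K) x.
Proof.
move=> xn; exists ('X^(n.+1) - c%:P); first exact: monicXnsubC.
by apply/rootP; rewrite rmorphB /= map_polyXn map_polyC /= !hornerE xn subrr.
Qed.

Lemma rat_integral_int (L : fieldExtType rat) (r : rat) :
  integralOver (intr : int -> L) (in_alg L r) -> r \is a Num.int.
Proof.
case=> g mg /rootP g0; rewrite -Cint_rat.
apply: Cint_rat_Aint; first exact: Crat_rat.
have gr : (map_poly intr g).[r] = 0 :> rat.
  apply: (fmorph_inj (in_alg L)).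
  by rewrite rmorph0 -horner_map map_in_alg_intr.
apply: (root_monic_Aint (p := map_poly intr g)).
- have := congr1 (ratr : rat -> algC) gr; rewrite rmorph0 -horner_map -map_poly_comp /=.
  by rewrite (eq_map_poly (fun x => ratr_int _ x)) => /rootP.
- exact: monic_map.
- by apply/polyOverP=> i; rewrite coef_map /= intr_int.
Qed.

(* If [p] divides [h_0, ..., h_(i-1)], then multiplying by [x ^ (n - i)] makes
   all terms but [h_i x ^ n / p] visibly integral; its [(n+1)]-st power is the
   rational number [(h_i / p) ^ (n+1) * c ^ n], which forces [p %| h_i]. *)
Lemma eisenstein_integral_dvd (L : fieldExtType rat) n (c : int) (p : nat)
    (x : L) (h : {poly int}) :
  prime p -> (p %| c)%Z -> ~~ (p%:Z ^+ 2 %| c)%Z -> x ^+ n.+1 = c%:~R ->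
  (size h <= n.+1)%N ->
  integralOver (intr : int -> L) (p%:R^-1 * (map_poly intr h).[x]) ->
  forall i, (p %| h`_i)%Z.
Proof.
move=> pp /dvdzP[c1 cE] p2c xn sh iy.
have char0 : (forall k : nat, (k%:R == 0 :> L) = (k == 0)%N).
  by move=> k; rewrite -(rmorph_nat (in_alg L)) fmorph_eq0 pnatr_eq0.
have p0 : p%:R != 0 :> L by rewrite char0 -lt0n prime_gt0.
have ix := integral_int_root xn.
have iint (z : int) : integralOver (intr : int -> L) z%:~R by exact: integral_id.
elim/ltn_ind=> i IHi; have [ltin|] := ltnP i n.+1; last first.
  by move=> le; rewrite nth_default ?dvdz0 // (leq_trans sh).
have iz : integralOver (intr : int -> L) (p%:R^-1 * (h`_i)%:~R * x ^+ n).
  have -> : p%:R^-1 * (h`_i)%:~R * x ^+ n =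
    p%:R^-1 * (map_poly intr h).[x] * x ^+ (n - i) -
    \sum_(k < n.+1 | k != Ordinal ltin) p%:R^-1 * (h`_k)%:~R * x ^+ (k + (n - i)).
    rewrite (horner_coef_wide _ (n := n.+1)); last first.
      by rewrite (leq_trans (size_poly _ _)).
    rewrite mulr_sumr mulr_suml (bigD1 (Ordinal ltin)) //= coef_map /=.
    rewrite -!mulrA -exprD subnKC // -addrA.
    rewrite -sumrB big1 ?addr0 // => k _.
    by rewrite coef_map /= exprD !mulrA subrr.
  apply: integral_sub; first by apply: integral_mul => //; apply: integral_exp.
  apply: (big_ind (integralOver intr)); [exact: integral0 | exact: integral_add|].
  (* For [k < i] the induction hypothesis cancels the denominator [p]. For [k > i] the exponent
     reaches [n.+1], and [x ^+ n.+1 = c] supplies the factor [p]. *)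
  move=> k; rewrite -val_eqE /= => ki; have /orP[kilt|kilt] : (k < i)%N || (i < k)%N by lia.
    have /dvdzP[z ->] := IHi _ kilt.
    rewrite rmorphM /= -[p%:~R]/(p%:R) mulrCA mulVf // mulr1.
    by apply: integral_mul => //; apply: integral_exp.
  have -> : (k + (n - i) = n.+1 + (k - i.+1))%N by lia.
  rewrite exprD xn cE rmorphM /= -[p%:~R]/(p%:R).
  rewrite [_ * (h`_k)%:~R]mulrC -mulrA.
  apply: integral_mul => //.
  have -> : p%:R^-1 * (c1%:~R * p%:R * x ^+ (k - i.+1)) = c1%:~R * x ^+ (k - i.+1).
    by rewrite [c1%:~R * _]mulrC -mulrA mulKf.
  by apply: integral_mul => //; apply: integral_exp.
have := integral_exp n.+1 iz.
have -> : (p%:R^-1 * (h`_i)%:~R * x ^+ n) ^+ n.+1 =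
   in_alg L ((h`_i ^+ n.+1 * c ^+ n)%:~R / (p ^ n.+1)%N%:R).
  rewrite fmorph_div rmorph_nat rmorph_int natrX.
  rewrite rmorphM !rmorphXn /= -xn -!exprM mulnC exprMn exprMn exprVn.
  by rewrite -!exprM [in RHS]mulrC mulrA [(n * _)%N]mulnC.
move/rat_integral_int/intrP=> [z ez].
have pq : (p ^ n.+1)%N%:R != 0 :> rat by rewrite pnatr_eq0 -lt0n expn_gt0 prime_gt0.
have {}ez : h`_i ^+ n.+1 * c ^+ n = z * (p ^ n.+1)%N%:Z.
  apply/eqP; rewrite -(eqr_int rat) [X in _ == X]rmorphM /= -ez.
  by rewrite -[(Posz _)%:~R]/(_%:R) divfK.
have : (p ^ n.+1 %| absz (h`_i)%R ^ n.+1 * `|c| ^ n)%N.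
  by rewrite -!abszX -abszM ez abszM dvdn_mull.
have absc : (`|c| = p * `|c1|)%N by rewrite cE abszM mulnC.
(* After cancelling [p ^ n], the prime [p] divides [h_i ^ n.+1 * c1 ^ n]; it cannot divide [c1],
   since [p ^ 2] does not divide [c]. *)
rewrite absc expnMn mulnCA expnSr dvdn_pmul2l ?expn_gt0 ?prime_gt0 //.
rewrite Euclid_dvdM // !Euclid_dvdX // => /orP[/andP[] // | /andP[pc1 _]].
case/negP: p2c; rewrite dvdzE abszX absc /= -mulnn dvdn_mul //.
Qed.

Lemma squarefree_prime (c : int) (p : nat) :
  squarefree c -> prime p -> ~~ (p%:Z ^+ 2 %| c)%Z.
Proof.
by move=> sc pp; apply/negP=> /sc; case: p pp => [|[|]].
Qed.

Lemma integral_denominator (L : fieldExtType rat) n (c : int) (x : L)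
    (f : {poly rat}) :
  powers_free n.+1 x ->
  c != 0 -> squarefree c -> x ^+ n.+1 = c%:~R -> (size f <= n.+1)%N ->
  integralOver (intr : int -> L) (map_poly (in_alg L) f).[x] ->
  n.+1%:R *: f \is a polyOver Num.int.
Proof.
move=> indep c0 sc xn sf iF.
have xn' : x ^+ n.+1 = in_alg L c%:~R by rewrite rmorph_int.
have ix := integral_int_root xn.
(* Up to sign, the trace is a coefficient of the characteristic polynomial of the integral element
   [f(x) x ^ (n.+1 - j)]. *)
have trf j : (j <= n)%N -> f`_j * c%:~R *+ n.+1 \is a Num.int.
  move=> jn; rewrite -(rootmx_horner_trace _ sf jn) -rpredN.
  rewrite -char_poly_trace //; apply/polyOverP.
  apply/(integral_char_poly _ indep xn').
  rewrite rmorphM /= map_polyXn hornerM hornerXn.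
  by apply: integral_mul => //; apply: integral_exp.
(* Induction on a divisor [d] of [c], removing one prime [p] with [d = e * p]. If [d * n.+1 * f = h]
   is integral, then [h(x) / p = e * n.+1 * f(x)] is an algebraic integer, so [p] divides every
   coefficient of [h] and [d] can be lowered to [e]. *)
have strip d : (d%:Z %| c)%Z -> d%:R *: (n.+1%:R *: f) \is a polyOver Num.int ->
   n.+1%:R *: f \is a polyOver Num.int.
  elim/ltn_ind: d => d IHd dc.
  have [d1|] := ltnP 1 d; last first.
    by case: d dc {IHd} => [|[|]] //; [rewrite dvd0z (negPf c0) | rewrite scale1r].
  have pp := pdiv_prime d1; set p := pdiv d in pp.
  have /dvdnP[e de] := pdiv_dvd d; rewrite -/p in de.
  have e0 : (0 < e)%N by case: e de d1 => // ->.
  case/floorpP=> h hE.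
  have p0 : p%:R != 0 :> rat by rewrite pnatr_eq0 -lt0n prime_gt0.
  have hE' : e%:R *: (n.+1%:R *: f) = p%:R^-1 *: map_poly intr h.
    by rewrite -hE [RHS]scalerA de natrM [_^-1 * _]mulrC mulfK.
  have sh : (size h <= n.+1)%N.
    rewrite -(size_map_inj_poly (f := intr : int -> rat)) //; last exact: intr_inj.
    by rewrite -hE !(leq_trans (size_scale_leq _ _)).
  apply: (IHd e).
  - by rewrite de -{1}[e]muln1 ltn_mul2l e0 prime_gt1.
  - by apply: dvdz_trans dc; rewrite de PoszM dvdz_mulr.
  rewrite hE'; apply/polyOverP=> i; rewrite coefZ coef_map /=.
  have /dvdzP[z ->] : (p %| h`_i)%Z.
    apply: (eisenstein_integral_dvd pp _ (squarefree_prime sc pp) xn sh).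
      by apply: dvdz_trans dc; rewrite de PoszM dvdz_mull.
    have -> : p%:R^-1 * (map_poly intr h).[x] =
        e%:R * (n.+1%:R * (map_poly (in_alg L) f).[x]).
      transitivity (map_poly (in_alg L) (p%:R^-1 *: map_poly intr h)).[x].
        by rewrite map_polyZ map_in_alg_intr hornerZ fmorphV rmorph_nat.
      by rewrite -hE' !map_polyZ !hornerZ !rmorph_nat.
    by apply: integral_mul; [exact: integral_nat | apply: integral_mul; [exact: integral_nat|]].
  by rewrite rmorphM mulrC mulfK // intr_int.
apply: (strip `|c|%N); first by rewrite dvdzE.
apply/polyOverP=> i; rewrite !coefZ; have [le|lt] := leqP i n; last first.
  by rewrite nth_default ?mulr0 // (leq_trans sf).
have -> : `|c|%N%:R * (n.+1%:R * f`_i) = (-1) ^+ (c < 0)%R * (f`_i * c%:~R *+ n.+1) :> rat.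
  have -> : c%:~R = (-1) ^+ (c < 0)%R * `|c|%N%:R :> rat.
    by rewrite {1}[c]intEsign rmorphM rmorphXn rmorphN1.
  by rewrite -mulr_natl; case: (c < 0)%R => /=; ring.
by rewrite rpredMsign trf.
Qed.

(** * Irreducibility of [X^n - c] and independence of powers *)

(** The hypotheses give [|c| > 1], so [c] has a prime divisor, and the polynomial is Eisenstein
    there. *)
Lemma XnsubC_squarefree_irreducible n (c : int) :
  squarefree c -> c != 1 -> c != -1 ->
  irreducible_poly ('X^(n.+1) - (c%:~R)%:P : {poly rat}).
Proof.
move=> sc c1 cN1.
have c0 : c != 0 by apply/eqP=> c0; have := sc 2; rewrite c0 dvdz0 => /(_ isT).
have absc : (1 < `|c|)%N by lia.
have pp := pdiv_prime absc; set p := pdiv _ in pp.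
have -> : 'X^(n.+1) - (c%:~R)%:P = map_poly intr ('X^(n.+1) - c%:P) :> {poly rat}.
  by rewrite rmorphB /= map_polyXn map_polyC.
apply/irreducible_rat_int.
have sz : size ('X^(n.+1) - c%:P) = n.+2 by apply: size_XnsubC.
apply: (eisenstein_crit pp).
- by rewrite sz.
- rewrite (monicP (monicXnsubC c (ltn0Sn n))) dvdzE /= dvdn1.
  by case: p pp => [|[|]].
- by rewrite coefB coefXn coefC /= sub0r rpredN; apply: squarefree_prime.
- move=> i; rewrite sz /= coefB coefXn coefC => ltin.
  rewrite (ltn_eqF ltin) sub0r rpredN; case: ifP => _; last exact: dvdz0.
  by rewrite dvdzE pdiv_dvd.
Qed.

(** This serves the radicand -1, which has no prime for Eisenstein. The polynomial is the cyclotomic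
    one of order [2 ^ k.+1]: a primitive root of unity of that order has degree
    [totient (2 ^ k.+1) = 2 ^ k]. *)
Lemma Xn_add1_irreducible k : irreducible_poly ('X^(2 ^ k) + 1 : {poly rat}).
Proof.
have [z zprim] := C_prim_root_exists (expn_gt0 2 k.+1 : (0 < 2 ^ k.+1)%N).
have zk : z ^+ (2 ^ k) = -1.
  have : (z ^+ (2 ^ k)) ^+ 2 == 1 by rewrite -exprM -expnSr (prim_expr_order zprim).
  rewrite sqrf_eq1 => /orP[|/eqP //].
  rewrite -(prim_order_dvd zprim) dvdn_Pexp2l // ltnn //.
have sz : size ('X^(2 ^ k) + 1 : {poly rat}) = (2 ^ k).+1.
  by apply: size_XnaddC; rewrite expn_gt0.
have rz : root (map_poly (ratr : rat -> algC) ('X^(2 ^ k) + 1)) z.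
  by apply/rootP; rewrite rmorphD rmorph1 /= map_polyXn !hornerE zk addNr.
apply/(subfx_irreducibleP rz); first by rewrite -size_poly_gt0 sz.
move=> q qz q0; have [p [pE _ pmin]] := minCpolyP z.
rewrite pmin in qz; apply: leq_trans (dvdp_leq q0 qz).
rewrite sz -(size_map_poly (ratr : {rmorphism rat -> algC})) -pE.
by rewrite (minCpoly_cyclotomic zprim) size_cyclotomic totient_pfactor ?mul1n.
Qed.

Lemma root_map_XnsubC (L : fieldExtType rat) n (c : int) (x : L) :
  x ^+ n = c%:~R -> root (map_poly (in_alg L) ('X^n - (c%:~R)%:P)) x.
Proof.
move=> xn; apply/rootP; rewrite rmorphB /= map_polyXn map_polyC !hornerE xn.
by apply/eqP; rewrite subr_eq0 eq_sym; apply/eqP/(rmorph_int (in_alg L)).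
Qed.

Lemma irreducible_root_indep (L : fieldExtType rat) (x : L) (p : {poly rat}) :
  irreducible_poly p -> root (map_poly (in_alg L) p) x ->
  powers_free (size p).-1 x.
Proof.
move=> irrp px f sf /rootP fx; apply/eqP/negPn/negP=> f0.
have p0 := irredp_neq0 irrp.
have /(_ f fx f0) le := (subfx_irreducibleP px p0).2 irrp.
by have := leq_trans le sf; rewrite leqNgt ltn_predL size_poly_gt0 p0.
Qed.

(** * Transfer of integral bases between the two radicands *)

(** Prime by prime, an exponent [h] in [n] becomes [(n * h)./2], which is at least [h] because
    [n >= 2]. *)
Lemma dvdn_n0 n : (2 < n)%N -> (n %| n0 n)%N.
Proof.
move=> n2; rewrite /n0 {1}(prod_prime_decomp (ltnW (ltnW n2))) prime_decompE big_map /=.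
apply: (big_ind2 (fun a b => a %| b)%N) => // [*|p _]; first exact: dvdn_mul.
by apply: dvdn_exp2l; rewrite -divn2; nia.
Qed.

(** Once elements are replaced by polynomials of size at most [n.+1], the generator [x] enters only
    through the predicate that [f(x)] is integral. Comparing two fields reduces to comparing these
    predicates. *)
Lemma integral_basis_poly (L : fieldExtType rat) n (c : int) (x : L) (d : nat)
    (v : 'I_d -> L) (b : 'I_d -> {poly rat}) :
  powers_free n.+1 x ->
  x ^+ n.+1 = c%:~R ->
  (forall j, v j = (map_poly (in_alg L) (b j)).[x]) ->
  (forall j, (size (b j) <= n.+1)%N) ->
  integral_basis <<1; x>>%AS v <->
  [/\ forall j, integralOver (intr : int -> L) (map_poly (in_alg L) (b j)).[x],
      forall f : {poly rat}, (size f <= n.+1)%N ->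
        integralOver (intr : int -> L) (map_poly (in_alg L) f).[x] ->
        exists k : 'I_d -> int, f = \sum_(j < d) b j *~ k j
    & forall k : 'I_d -> int,
        \sum_(j < d) b j *~ k j = 0 -> forall j, k j = 0].
Proof.
move=> indep xn vb sb.
have evK f : (map_poly (in_alg L) f).[x] \in <<1; x>>%AS.
  by apply/Fadjoin_polyP; exists (map_poly (in_alg L) f) => //; exact: alg_polyOver.
have Kev y : y \in <<1; x>>%AS ->
    exists2 f : {poly rat}, (size f <= n.+1)%N & y = (map_poly (in_alg L) f).[x].
  case/Fadjoin_polyP=> _ /polyOver1P[f ->] ->.
  (* Reduction modulo [X^(n.+1) - c] keeps the value at [x] and bounds the size by [n.+1]. *)
  pose p : {poly rat} := 'X^(n.+1) - (c%:~R)%:P.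
  exists (f %% p).
    have sp : size p = n.+2 by apply: size_XnsubC.
    by rewrite -ltnS -sp ltn_modp -size_poly_gt0 sp.
  by rewrite map_modp horner_mod //; apply: root_map_XnsubC.
have evS (k : 'I_d -> int) : (map_poly (in_alg L) (\sum_j b j *~ k j)).[x] = \sum_j v j *~ k j.
  rewrite (raddf_sum (map_poly (in_alg L))) horner_sum; apply: eq_bigr => j _ /=.
  by rewrite -scaler_int map_polyZ hornerZ rmorph_int mulrzl vb.
have sS (k : 'I_d -> int) : (size (\sum_j b j *~ k j)%R <= n.+1)%N.
  apply: (leq_trans (size_sum _ _ _)); apply/bigmax_leqP=> j _.
  by rewrite -scaler_int (leq_trans (size_scale_leq _ _)).
split=> [[bI gen free]|[bI gen free]].
  split=> [j|f sf fI|k k0].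
  - by rewrite -vb; have [] := bI j.
  - have [k kE] := gen _ (conj (evK f) fI); exists k.
    apply/eqP; rewrite -subr_eq0; apply/eqP/indep.
      by rewrite (leq_trans (size_polyD _ _)) // size_polyN geq_max sf sS.
    by rewrite rmorphB hornerD hornerN evS kE subrr.
  - by apply: free; rewrite -evS k0 rmorph0 horner0.
split=> [j|y [/Kev[f sf ->] fI]|k k0].
- by rewrite /ring_of_integers vb evK; split.
- by have [k ->] := gen f sf fI; exists k; rewrite evS.
- by apply: free; apply: indep => //; rewrite evS.
Qed.

(** The denominator bound writes [f] as [h / n.+1] with [h] integral. The characteristic polynomials
    of [f] at the two companion matrices then differ by an integral polynomial, so one is integral
    if the other is. *)
Lemma integral_radicand_congr (L L' : fieldExtType rat) n (c c' : int)
    (x : L) (x' : L') (f : {poly rat}) :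
  (0 < n)%N -> c != 0 -> squarefree c ->
  powers_free n.+1 x ->
  powers_free n.+1 x' ->
  x ^+ n.+1 = c%:~R -> x' ^+ n.+1 = c'%:~R ->
  ((n.+1 ^ n.+1)%N %| c' - c)%Z -> (size f <= n.+1)%N ->
  integralOver (intr : int -> L) (map_poly (in_alg L) f).[x] ->
  integralOver (intr : int -> L') (map_poly (in_alg L') f).[x'].
Proof.
move=> n0 c0 sc ind ind' xn xn' cc' sf fI.
have xq : x ^+ n.+1 = in_alg L c%:~R by rewrite rmorph_int.
have xq' : x' ^+ n.+1 = in_alg L' c'%:~R by rewrite rmorph_int.
have /floorpP[h hE] := integral_denominator ind c0 sc xn sf fI.
have fE : f = n.+1%:R^-1 *: map_poly intr h.
  by rewrite -hE scalerA mulVf ?scale1r // pnatr_eq0.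
move/(integral_char_poly _ ind xq): fI => fI.
apply/(integral_char_poly _ ind' xq').
have N1 : (1 < n.+1)%N by [].
have := char_poly_scale_congr h N1 cc'; rewrite -fE => dI.
apply/polyOverP=> i.
by have := rpredD (polyOverP dI i) (polyOverP fI i); rewrite coefB subrK.
Qed.

Lemma integral_basis_radicand_congr (L L' : fieldExtType rat) n (c c' : int)
    (x : L) (x' : L') (a : 'I_n.+1 -> 'I_n.+1 -> int) (q : 'I_n.+1 -> int) :
  (0 < n)%N -> c != 0 -> squarefree c -> c' != 0 -> squarefree c' ->
  powers_free n.+1 x ->
  powers_free n.+1 x' ->
  x ^+ n.+1 = c%:~R -> x' ^+ n.+1 = c'%:~R ->
  ((n.+1 ^ n.+1)%N %| c' - c)%Z ->
  integral_basis <<1; x>>%AS (basis_elt a q x) <->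
  integral_basis <<1; x'>>%AS (basis_elt a q x').
Proof.
move=> n0 c0 sc c0' sc' ind ind' xn xn' cc'.
have c'c : ((n.+1 ^ n.+1)%N %| c - c')%Z by rewrite -rpredN opprB.
pose b j : {poly rat} := \sum_(i < n.+1) ((a j i)%:~R / (q j)%:~R) *: 'X^i.
have sb j : (size (b j) <= n.+1)%N.
  apply: (leq_trans (size_sum _ _ _)); apply/bigmax_leqP=> i _.
  by rewrite (leq_trans (size_scale_leq _ _)) // size_polyXn.
have bE (K : fieldExtType rat) (y : K) j :
    basis_elt a q y j = (map_poly (in_alg K) (b j)).[y].
  rewrite /basis_elt /b (raddf_sum (map_poly (in_alg K))) horner_sum mulr_suml.
  apply: eq_bigr => i _ /=.
  by rewrite map_polyZ map_polyXn hornerZ hornerXn fmorph_div !rmorph_int mulrAC.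
have equivI (f : {poly rat}) : (size f <= n.+1)%N ->
    integralOver (intr : int -> L) (map_poly (in_alg L) f).[x] <->
    integralOver (intr : int -> L') (map_poly (in_alg L') f).[x'].
  by move=> sf; split; [exact: (integral_radicand_congr n0 c0 sc ind ind' xn xn' cc' sf) |
    exact: (integral_radicand_congr n0 c0' sc' ind' ind xn' xn c'c sf)].
apply: iff_trans (integral_basis_poly ind xn (bE _ _) sb) _.
apply: iff_trans _ (iff_sym (integral_basis_poly ind' xn' (bE _ _) sb)).
by split=> -[bI gen free]; split=> // [j|f sf fI];
  [exact/(equivI _ (sb j)) | apply: gen => //; exact/(equivI _ sf)
  |exact/(equivI _ (sb j)) | apply: gen => //; exact/(equivI _ sf)].
Qed.

Theorem theorem2 (n : nat) (m : int)
    (hn : (2 < n)%N)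
    (hm0 : m <> 0) (hm1 : m <> 1) (hmN1 : m <> -1)
    (hm : squarefree m)
    (hm' : squarefree (m + (n0 n)%:Z ^+ n))
    (* nondegeneracy: these exclude exactly the cases [Q(gamma) : Q] < n *)
    (hm'1 : m + (n0 n)%:Z ^+ n <> 1)
    (hm'N1 : m + (n0 n)%:Z ^+ n = -1 -> exists k : nat, n = (2 ^ k)%N)
    (L L' : fieldExtType rat) (theta : L) (gamma : L')
    (htheta : theta ^+ n = m%:~R)
    (hgamma : gamma ^+ n = (m + (n0 n)%:Z ^+ n)%:~R)
    (a : 'I_n -> 'I_n -> int) (q : 'I_n -> int)
    (hq : forall j, 0 < q j) :
  integral_basis <<1; theta>>%AS (basis_elt a q theta) <->
  integral_basis <<1; gamma>>%AS (basis_elt a q gamma).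
Proof.
have indep (K : fieldExtType rat) (y : K) (c : int) :
    squarefree c -> c <> 1 -> (c = -1 -> exists k, n = (2 ^ k)%N) ->
    y ^+ n = c%:~R -> powers_free n y.
  move=> sc /eqP c1 cN1 yn.
  have n_gt0 : (0 < n)%N by apply: leq_trans hn.
  have irr : irreducible_poly ('X^n - (c%:~R)%:P : {poly rat}).
    (* For [c = -1] the exponent is a power of 2 and the polynomial is cyclotomic; any other [c]
       here is covered by Eisenstein. *)
    have [cE|cN] := eqVneq c (-1).
      have [k ->] := cN1 cE; rewrite cE !rmorphN1 opprK.
      exact: Xn_add1_irreducible.
    by rewrite -(prednK n_gt0); apply: XnsubC_squarefree_irreducible.
  have := irreducible_root_indep irr (x := y); rewrite size_XnsubC //; apply.
  exact: root_map_XnsubC.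
set m' := m + _ in hm' hm'1 hm'N1 hgamma.
have m'0 : m' != 0 by apply/eqP=> m'0; have := hm' 2; rewrite m'0 dvdz0 => /(_ isT).
(* The difference of the radicands is [n0 n ^ n], and [n] divides [n0 n]. *)
have dvd : ((n ^ n)%N %| m' - m)%Z.
  by rewrite /m' addrC addKr dvdzE abszX /= dvdn_exp2r // dvdn_n0.
have ind := indep L theta m hm hm1 (fun e => False_ind _ (hmN1 e)) htheta.
have ind' := indep L' gamma m' hm' hm'1 hm'N1 hgamma.
(* The matrix lemmas are stated for size [n.+1], so [n] is turned into a successor, along with
   everything that depends on it. *)
move: a q {hq} ind ind' htheta hgamma dvd.
case: n hn {hm'N1 indep} @m' hm' hm'1 m'0 => // n hn m' hm' hm'1 m'0 a q ind ind' ht hg dvd.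
have n_gt0 : (0 < n)%N by lia.
have m0 : m != 0 by apply/eqP.
exact: (integral_basis_radicand_congr a q n_gt0 m0 hm m'0 hm' ind ind' ht hg dvd).
Qed.
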